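(* On the domain of lexicographic preferences, MPS is sd-weakly-strategyproof: for every profile $R=(\succ_j)_{j\le n}$ of lexicographic preferences, every agent $j$, and every lexicographic preference $\succ'_j$ (possibly with a different importance order), letting $R'=(\succ'_j,\succ_{-j})$, if $\mathrm{MPS}(R')_j$ weakly stochastically dominates $\mathrm{MPS}(R)_j$ w.r.t. $\succ_j$, then $\mathrm{MPS}(R')_j=\mathrm{MPS}(R)_j$.
   Context: Setting: $N=\{1,\dots,n\}$ agents; $M=D_1\cup\dots\cup D_p$ items with pairwise disjoint types, $|D_i|=n$, unit supply; bundles $\mathcal D=D_1\times\dots\times D_p$, $x_i$ the type-$i$ component of $x$. An assignment is an $n\times|\mathcal D|$ matrix $(p_{j,x})$ with entries in $[0,1]$, rows summing to $1$, and $\sum_j\sum_{x\ni o}p_{j,x}=1$ for each item $o$. Lexicographic preference: importance order $\rhd_j$ over types and strict orders $\rhd^i_j$ on each $D_i$; $x\succ_j y$ iff there is a type $i$ with $x_i\rhd^i_j y_i$ and $x_{i'}=y_{i'}$ for all $i'\rhd_j i$. $U(\succ,x)=\{y:y\succ x\}\cup\{x\}$; $p$ weakly stochastically dominates $q$ w.r.t. $\succ$ if $\sum_{y\in U(\succ,x)}p_y\ge\sum_{y\in U(\succ,x)}q_y$ for all $x$. MPS: items start with supply $1$; a bundle is available if all its items have positive remaining supply. Continuously in time each agent eats her most preferred available bundle at rate $1$ (each item of it consumed at rate $1$, $p_{j,x}$ growing at rate $1$); exhausted items make all bundles containing them unavailable; the process runs until all items are exhausted; the accumulated matrix is $\mathrm{MPS}(R)$.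 *)

(* Defs.v *)
From HB Require Import structures.
From mathcomp Require Import all_boot all_order all_algebra all_fingroup.
From mathcomp Require Import reals.
Set Implicit Arguments. Unset Strict Implicit. Unset Printing Implicit Defensive.
Import Order.TTheory GRing.Theory Num.Theory.
Local Open Scope ring_scope.

Section MPS.
Variables (n p : nat).

(* Types are 'I_p, the items of type i are (i, k) with k : 'I_n. *)
Definition item := ('I_p * 'I_n)%type.
Definition bundle := {ffun 'I_p -> 'I_n}.
Definition in_bundle (o : item) (x : bundle) : bool := x o.1 == o.2.

(* A lexicographic preference: an importance order on types, given by the
   rank of each type (rank 0 = most important), and for each type a strict
   order on its items, given by the rank of each item (rank 0 = best). *)
Record lexpref := LexPref {
  imp_rank : {perm 'I_p};
  item_rank : 'I_p -> {perm 'I_n} }.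

Definition more_important (L : lexpref) (i' i : 'I_p) : bool :=
  (imp_rank L i' < imp_rank L i)%N.
Definition item_better (L : lexpref) (i : 'I_p) (a b : 'I_n) : bool :=
  (item_rank L i a < item_rank L i b)%N.

Definition prefer (L : lexpref) (x y : bundle) : bool :=
  [exists i, item_better L i (x i) (y i) &&
     [forall i', more_important L i' i ==> (x i' == y i')]].

Definition upper (L : lexpref) (x : bundle) : pred bundle :=
  [pred y | prefer L y x || (y == x)].

Variable R : realType.

Definition sd_dom (L : lexpref) (q r : {ffun bundle -> R}) : Prop :=
  forall x : bundle, \sum_(y in upper L x) r y <= \sum_(y in upper L x) q y.

Definition profile := 'I_n -> lexpref.
Definition assignment := 'I_n -> {ffun bundle -> R}.
Definition supply := {ffun item -> R}.

Definition update (P : profile) (j : 'I_n) (L' : lexpref) : profile :=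
  fun k => if k == j then L' else P k.

Definition available (s : supply) (x : bundle) : bool :=
  [forall i, 0 < s (i, x i)].

(* most preferred available bundle (unique, since lexicographic orders are total) *)
Definition top (L : lexpref) (s : supply) : option bundle :=
  [pick x | available s x &&
     [forall y, (available s y && (y != x)) ==> prefer L x y]].

Definition eats (L : lexpref) (s : supply) (x : bundle) : bool :=
  top L s == Some x.

Definition rate (P : profile) (s : supply) (o : item) : nat :=
  #|[set k : 'I_n | if top (P k) s is Some x then in_bundle o x else false]|.

(* length of the current phase: time until the next item is exhausted
   (supplies never exceed 1, so the default 1 is never the binding value
   when some item is being eaten) *)
Definition phase_len (P : profile) (s : supply) : R :=
  \big[Num.min/1]_(o | (0 < rate P s o)%N) (s o / (rate P s o)%:R).

Definition step (P : profile) (st : supply * assignment) : supply * assignment :=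
  let (s, A) := st in
  let d := phase_len P s in
  ([ffun o => s o - (rate P s o)%:R * d],
   fun k => if top (P k) s is Some x
            then [ffun y => A k y + (if y == x then d else 0)]
            else A k).

Definition init : supply * assignment := ([ffun _ => 1], fun _ => [ffun _ => 0]).

(* Each phase exhausts at least one item, so after #items phases every item
   is exhausted; further iterations change nothing. *)
Definition MPS (P : profile) : assignment := (iter (p * n).+1 (step P) init).2.

End MPS.

(* Main.v *)
(** Availability is a product over types, so an agent with a lexicographic
    preference always eats her best remaining item of each type, independently
    of the importance order: MPS couples one probabilistic serial (PS) process
    per type.  A PS process is encoded by the exhaustion times [tau] of the
    items: an agent eats [o] from the time her better items are exhausted until
    [tau o], and these durations sum to 1 over the agents.

    For one type, suppose the deviation dominates.  Going down the true ranking
    of the deviator, both processes agree until the exhaustion time of her next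
    item [a]: if she ate something else meanwhile, the other items would be
    exhausted no later than before, the other agents would reach [a] no later,
    and she could not recover her share of [a], unless nobody shares [a] with
    her, in which case she gets all of it.

    For several types, go through them by decreasing importance: if both joint
    distributions have the same marginal on the first types, sd-dominance
    restricted to a fixed choice of these gives dominance on the next type, so
    the case of one type gives equality there, and the nonnegative differences
    over the choices, which sum to zero, all vanish. *)

Require Import Defs.
From HB Require Import structures.
From mathcomp Require Import all_boot all_order all_algebra all_fingroup.
From mathcomp Require Import reals.
From mathcomp Require Import lra.
Set Implicit Arguments. Unset Strict Implicit. Unset Printing Implicit Defensive.
Import Order.TTheory GRing.Theory Num.Theory.
Local Open Scope ring_scope.

(** * One agent's consumption computed from exhaustion times *)

Section Eating.
Variables (R : realFieldType) (O : finType).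
Implicit Types (rk : O -> nat) (tau : O -> R) (o b : O) (v : R).

(* The time at which every item of rank below [r] is exhausted. *)
Definition busy rk tau r : R := \big[Num.max/0]_(b | (rk b < r)%N) tau b.

Definition eaten rk tau o : R := Num.max 0 (tau o - busy rk tau (rk o)).

Lemma busy_ge0 rk tau r : 0 <= busy rk tau r.
Proof. exact: bigmax_ge_id. Qed.

Lemma le_busy rk tau r o : (rk o < r)%N -> tau o <= busy rk tau r.
Proof. by move=> h; rewrite /busy (le_bigmax_cond _ (P := fun b => (rk b < r)%N)). Qed.

Lemma busy_le rk tau r v :
  0 <= v -> (forall o, (rk o < r)%N -> tau o <= v) -> busy rk tau r <= v.
Proof. exact: bigmax_le. Qed.

Lemma busy_mono rk tau r s : (r <= s)%N -> busy rk tau r <= busy rk tau s.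
Proof.
move=> rs; apply: busy_le => [|o ho]; first exact: busy_ge0.
by apply: le_busy; apply: leq_trans rs.
Qed.

Lemma busyS rk tau o : injective rk ->
  busy rk tau (rk o).+1 = Num.max (busy rk tau (rk o)) (tau o).
Proof.
move=> rk_inj; apply/le_anti/andP; split.
  apply: busy_le => [|b]; first by rewrite le_max busy_ge0.
  rewrite ltnS leq_eqVlt => /orP[/eqP/rk_inj ->|h]; rewrite le_max ?lexx ?orbT //.
  by rewrite le_busy.
by rewrite ge_max busy_mono // le_busy.
Qed.

Lemma eaten_ge0 rk tau o : 0 <= eaten rk tau o.
Proof. by rewrite /eaten le_max lexx. Qed.

Lemma eaten_gt0 rk tau o : (0 < eaten rk tau o) = (busy rk tau (rk o) < tau o).
Proof. by rewrite /eaten lt_max ltxx subr_gt0. Qed.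

Lemma big_rank_ltS rk o (f : O -> R) : injective rk ->
  \sum_(b | (rk b < (rk o).+1)%N) f b = f o + \sum_(b | (rk b < rk o)%N) f b.
Proof.
move=> rk_inj; rewrite (bigD1 o) //=; congr (_ + _); apply: eq_bigl => b.
rewrite ltnS leq_eqVlt (inj_eq rk_inj).
by case: eqVneq => [->|]; rewrite ?ltnn ?andbT ?andbF.
Qed.

(** The sum telescopes: what is eaten of [o] is the increment of [busy] from rank [rk o] to the next
    rank. *)
Lemma sum_eaten rk tau r : injective rk ->
  \sum_(o | (rk o < r)%N) eaten rk tau o = busy rk tau r.
Proof.
move=> rk_inj; elim: r => [|r IHr]; first by rewrite /busy !big_pred0.
case: (pickP (fun o => rk o == r)) => [o /eqP ro | no]; last first.
  have E o : (rk o < r.+1)%N = (rk o < r)%N by rewrite ltnS leq_eqVlt no.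
  by rewrite (eq_bigl _ _ E) IHr /busy (eq_bigl _ _ E).
rewrite -ro big_rank_ltS // ro IHr -ro busyS // /eaten; move: (busy _ _ _) (tau o) => x y.
rewrite /Num.max; case: ifP; case: ifP => *; lra.
Qed.

(** Stops the clock at [v]: for [0 <= v], [eaten rk (cap v tau) o] is the amount of [o] eaten by
    time [v]. *)
Definition cap v tau o : R := Num.min (tau o) v.

Lemma busy_cap_le rk tau v r : busy rk (cap v tau) r <= busy rk tau r.
Proof.
apply: busy_le => [|o ho]; first exact: busy_ge0.
by rewrite ge_min le_busy.
Qed.

Lemma rank_bound rk : exists r, forall o, (rk o < r)%N.
Proof. by exists (\max_o rk o).+1 => o; rewrite ltnS leq_bigmax. Qed.

Lemma sum_eaten_cap rk tau v : injective rk -> 0 <= v ->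
  \sum_o eaten rk (cap v tau) o <= v.
Proof.
move=> rk_inj v0; have [r rP] := rank_bound rk.
rewrite (eq_bigl (fun o => (rk o < r)%N)) => [|o]; last by rewrite rP.
by rewrite sum_eaten //; apply: busy_le => // o _; rewrite ge_min lexx orbT.
Qed.

Lemma le_eaten_cap rk tau v o : tau o <= v -> eaten rk tau o <= eaten rk (cap v tau) o.
Proof.
move=> tv; rewrite /eaten ge_max !le_max lexx /=; apply/orP; right.
by rewrite /cap min_l // lerD2l lerN2 busy_cap_le.
Qed.

(** Eating proceeds one item at a time at unit rate, so items that are all gone by time [v] yield at
    most [v] together. *)
Lemma sum_eaten_le rk tau v (Q : pred O) : injective rk -> 0 <= v ->
  (forall o, Q o -> tau o <= v) -> \sum_(o | Q o) eaten rk tau o <= v.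
Proof.
move=> rk_inj v0 Qv; apply: le_trans (sum_eaten_cap tau rk_inj v0).
rewrite [leRHS](bigID Q) /= -[leLHS]addr0 lerD ?sumr_ge0 // => [|o _]; last exact: eaten_ge0.
by apply: ler_sum => o /Qv; apply: le_eaten_cap.
Qed.

(* Until time [v] the agent has room for nothing outside [Q]. *)
Lemma busy_until rk tau v (Q : pred O) o : injective rk -> 0 <= v ->
    (forall b, Q b -> tau b <= v) -> v <= \sum_(b | Q b) eaten rk tau b ->
  ~~ Q o -> busy rk tau (rk o) < v -> tau o <= busy rk tau (rk o).
Proof.
move=> rk_inj v0 Qv sumQ nQo bv; rewrite leNgt; apply/negP => bo.
suff : \sum_(b | Q b) eaten rk tau b + eaten rk (cap v tau) o <= v.
  have : 0 < eaten rk (cap v tau) o.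
    rewrite eaten_gt0; apply: le_lt_trans (busy_cap_le _ _ _ _) _.
    by rewrite lt_min bo bv.
  by lra.
apply: le_trans (sum_eaten_cap tau rk_inj v0).
rewrite [leRHS](bigID Q) /= lerD //.
  by apply: ler_sum => b /Qv; apply: le_eaten_cap.
rewrite (bigD1 o) //= lerDl sumr_ge0 // => b _; exact: eaten_ge0.
Qed.

End Eating.

(** * Equilibria of exhaustion times for one type, and their comparison *)

Section Equilibrium.
Variables (R : realFieldType) (A O : finType).
Implicit Types (rk : A -> O -> nat) (tau : O -> R) (k j : A) (o b : O).

Definition equilibrium rk tau := forall o, \sum_k eaten (rk k) tau o = 1.

Lemma eater_ex rk tau o : equilibrium rk tau ->
  exists k, busy (rk k) tau (rk k o) < tau o.
Proof.
move=> eq; apply/existsP; apply: contraT; rewrite negb_exists => /forallP no.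
have := eq o; rewrite big1 => [/eqP|k _]; first by rewrite eq_sym oner_eq0.
by apply/eqP; rewrite eq_le eaten_ge0 andbT leNgt eaten_gt0 no.
Qed.

Lemma exhaustion_gt0 rk tau o : equilibrium rk tau -> 0 < tau o.
Proof. by case/(eater_ex o)=> k; apply: le_lt_trans; apply: busy_ge0. Qed.

(** Every agent's total is the last exhaustion time, hence the same for all; the totals add up to
    [#|O|], which is the number of agents. *)
Lemma sum_eaten_eq1 rk tau k : #|A| = #|O| -> (forall k, injective (rk k)) ->
  equilibrium rk tau -> \sum_o eaten (rk k) tau o = 1.
Proof.
move=> AO rk_inj eq.
have total i : \sum_o eaten (rk i) tau o = \big[Num.max/0]_o tau o.
  have [r rP] := rank_bound (rk i).
  transitivity (\sum_(o | (rk i o < r)%N) eaten (rk i) tau o).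
    by apply: eq_bigl => o; rewrite rP.
  by rewrite sum_eaten // /busy; apply: eq_bigl => o; rewrite rP.
have : \sum_i \sum_o eaten (rk i) tau o = #|O|%:R.
  by rewrite exchange_big /= (eq_bigr (fun=> 1)) // sumr_const.
rewrite (eq_bigr _ (fun i _ => total i)) sumr_const -AO total => h.
apply: (mulIf (x := #|A|%:R)); last by rewrite mul1r mulr_natr.
by rewrite pnatr_eq0 -lt0n; apply/card_gt0P; exists k.
Qed.

(** If [o] lasted longer under [tau'], nobody would get less of it and [k0] would get strictly more,
    exceeding the unit supply. The second alternative serves the deviator, whose share is bounded
    directly rather than through her starting time. *)
Lemma exhaustion_le rk tau rk' tau' o k0 :
    equilibrium rk tau -> equilibrium rk' tau' ->
    busy (rk k0) tau (rk k0 o) < tau o ->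
    busy (rk' k0) tau' (rk' k0 o) <= busy (rk k0) tau (rk k0 o) ->
    (forall k, busy (rk k) tau (rk k o) < tau o ->
       busy (rk' k) tau' (rk' k o) <= busy (rk k) tau (rk k o) \/
       eaten (rk k) tau o <= eaten (rk' k) tau' o) ->
  tau' o <= tau o.
Proof.
move=> eq eq' lt0 le0 lek; rewrite leNgt; apply/negP => tt'.
have le k : eaten (rk k) tau o <= eaten (rk' k) tau' o.
  have [bt|bt] := ltP (busy (rk k) tau (rk k o)) (tau o).
    case: (lek k bt) => // h; rewrite /eaten ge_max !le_max lexx /=.
    by apply/orP; right; lra.
  by rewrite {1}/eaten max_l ?subr_le0 // eaten_ge0.
have lt : eaten (rk k0) tau o < eaten (rk' k0) tau' o.
  rewrite /eaten gt_max !lt_max ltxx /=.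
  by apply/andP; split; [|apply/orP; right]; lra.
have : \sum_k eaten (rk k) tau o < \sum_k eaten (rk' k) tau' o.
  by rewrite (bigD1 k0) //= [ltRHS](bigD1 k0) //= ltr_leD // ler_sum.
by rewrite eq eq' ltxx.
Qed.

Section Deviation.
Variables (j : A) (rk rk' : A -> O -> nat) (tau tau' : O -> R).
Hypotheses (eq : equilibrium rk tau) (eq' : equilibrium rk' tau').
Hypothesis (dev : forall k, k != j -> rk' k = rk k).

(** An agent other than [j] who eats [o] under [tau] has finished her better items before [tau o],
    so she starts on [o] no later under [tau']. If [j] herself eats [o], the second premise
    concludes. *)
Lemma exhausted_earlier o :
    (forall b, tau b < tau o -> tau' b <= tau b) ->
    (busy (rk j) tau (rk j o) < tau o -> tau' o <= tau o) ->
  tau' o <= tau o.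
Proof.
move=> before jo.
have [|joF] := ltP (busy (rk j) tau (rk j o)) (tau o); first exact: jo.
have le k : busy (rk k) tau (rk k o) < tau o ->
    busy (rk' k) tau' (rk' k o) <= busy (rk k) tau (rk k o).
  move=> kb; have kj : k != j by apply: contraTneq kb => ->; rewrite -leNgt.
  rewrite dev //; apply: busy_le => [|b bo]; first exact: busy_ge0.
  have tb := le_busy tau bo.
  by apply: le_trans tb; apply: before; apply: le_lt_trans kb; apply: le_busy.
have [k0 k0P] := eater_ex o eq.
by apply: (exhaustion_le eq eq' k0P (le k0 k0P)) => k kb; left; apply: le.
Qed.

End Deviation.

Definition agree_until tau tau' (v : R) :=
  forall o, tau o <= v \/ tau' o <= v -> tau o = tau' o.

(** Only the items that [j] eats need checking. At the earliest discrepancy, with [m o] the smaller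
    of the two times, the processes coincide beforehand, and [exhausted_earlier] applies in one
    direction or the other. *)
Lemma agree_until_eaten j rk rk' tau tau' v :
    equilibrium rk tau -> equilibrium rk' tau' ->
    (forall k, k != j -> rk' k = rk k) ->
    (forall o, tau o <= v -> busy (rk j) tau (rk j o) < tau o -> tau o = tau' o) ->
    (forall o, tau' o <= v -> busy (rk' j) tau' (rk' j o) < tau' o -> tau o = tau' o) ->
  agree_until tau tau' v.
Proof.
move=> eq eq' dev jt jt'.
pose m o := Num.min (tau o) (tau' o).
pose bad o := (m o <= v) && (tau o != tau' o).
case: (pickP bad) => [o0 bad0 | good]; last first.
  move=> o tv; move/negbT: (good o); rewrite negb_and negbK => /orP[|/eqP //].
  by rewrite /m ge_min; case: tv => ->; rewrite ?orbT.
case: (arg_minP m bad0) => o /andP[mv neq] omin.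
have good b : m b < m o -> tau b = tau' b.
  move=> bo; apply/eqP; apply: contraTT bo => nb; rewrite -leNgt.
  have [mbv|/ltW vb] := leP (m b) v; first by apply: omin; rewrite /bad mbv nb.
  exact: le_trans vb.
have [lt|lt|E] := ltgtP (tau o) (tau' o); last by rewrite E eqxx in neq.
- have mo : m o = tau o by rewrite /m min_l // ltW.
  suff : tau' o <= tau o by lra.
  apply: (exhausted_earlier eq eq' dev) => [b bo|jo].
    by rewrite (good b) // mo /m gt_min bo.
  by rewrite (jt o) // -mo.
- have mo : m o = tau' o by rewrite /m min_r // ltW.
  suff : tau o <= tau' o by lra.
  apply: (exhausted_earlier (j := j) eq' eq) => [k kj|b bo|jo].
  + by rewrite dev.
  + by rewrite (good b) // mo /m gt_min bo orbT.
  + by rewrite (jt' o) // -mo.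
Qed.

(** * Weak strategyproofness for a single type *)

Section WeakStrategyproofness.
Variables (j : A) (rk rk' : A -> O -> nat) (tau tau' : O -> R).
Hypotheses (AO : #|A| = #|O|).
Hypotheses (rk_inj : forall k, injective (rk k)).
Hypotheses (rk'_inj : forall k, injective (rk' k)).
Hypotheses (eq : equilibrium rk tau) (eq' : equilibrium rk' tau').
Hypothesis (dev : forall k, k != j -> rk' k = rk k).
Hypothesis (dom : forall r, \sum_(o | (rk j o < r)%N) eaten (rk j) tau o <=
                            \sum_(o | (rk j o < r)%N) eaten (rk' j) tau' o).

(** The alternative [1 <= tau a] arises when nobody shares [a] with [j]; a full unit settles the
    comparison, since no agent gets more than 1 in total. *)
Lemma agree_step a :
  let t := busy (rk j) tau (rk j a) in
  t < tau a -> agree_until tau tau' t ->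
  agree_until tau tau' (tau a) \/ 1 <= tau a.
Proof.
move=> t ta agr; set u := tau a in ta *.
have t0 : 0 <= t by exact: busy_ge0.
have better o : (rk j o < rk j a)%N -> tau o <= t by move=> h; apply: le_busy.
have worse o : tau o < u -> (rk j a < rk j o)%N -> tau o <= busy (rk j) tau (rk j o).
  by move=> ou ao; apply: ltW; apply: lt_le_trans ou _; apply: le_busy.
(* Consider the earliest violation [b]: if [j] eats [b] truthfully, then [b] is better than [a] for
   her, and there the processes agree. *)
have earlier o : o != a -> tau o < u -> tau' o <= tau o.
  move=> oa ou; pose bad o := [&& o != a, tau o < u & tau o < tau' o].
  rewrite leNgt; apply/negP => oo'.
  have bad_o : bad o by rewrite /bad oa ou.
  case: (arg_minP tau bad_o) => b /and3P[ba bu bb'] bmin.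
  suff : tau' b <= tau b by rewrite leNgt bb'.
  apply: (exhausted_earlier eq eq' dev) => [c cb|jb].
    have cu : tau c < u by exact: lt_trans bu.
    have ca : c != a by apply: contraTneq cu => ->; rewrite ltxx.
    rewrite leNgt; apply: contraL cb => cc'; rewrite -leNgt bmin //.
    by rewrite /bad ca cu.
  case: (ltngtP (rk j b) (rk j a)) => [lt|gt|/rk_inj E].
  - by rewrite -(agr b) //; left; apply: better.
  - by have := worse b bu gt; rewrite leNgt jb.
  - by rewrite E eqxx in ba.
have inj_j := @rk_inj j; have inj_j' := @rk'_inj j.
have sum_u : \sum_(o | (rk j o < (rk j a).+1)%N) eaten (rk j) tau o = u.
  by rewrite sum_eaten // busyS // max_r // ltW.
have better' o : (rk j o < rk j a)%N -> tau' o <= t.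
  by move=> h; rewrite -(agr o); [|left]; apply: better.
(* Dominance up to [a] demands a total of [u], of which the items better than [a] provide at most
   [t]. *)
have ja : u - t <= eaten (rk' j) tau' a.
  have := dom (rk j a).+1; rewrite sum_u big_rank_ltS //.
  have := sum_eaten_le inj_j' t0 better'; lra.
have eat_a : eaten (rk j) tau a = u - t by rewrite /eaten max_r // subr_ge0 ltW.
case: (pickP (fun k => (k != j) && (busy (rk k) tau (rk k a) < u))); last first.
  (* [j] alone eats [a], hence receives all of it *)
  move=> alone; right; have := eq a; rewrite (bigD1 j) //= eat_a big1 ?addr0; first lra.
  move=> k kj; have := alone k; rewrite kj /= => /negbT; rewrite -leNgt => h.
  by rewrite /eaten max_l // subr_le0.
move=> k0 /andP[k0j k0a]; left.
have le k : k != j -> busy (rk k) tau (rk k a) < u ->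
    busy (rk' k) tau' (rk' k a) <= busy (rk k) tau (rk k a).
  move=> kj kb; rewrite dev //; apply: busy_le => [|b ba]; first exact: busy_ge0.
  have tb := le_busy tau ba; have bu := le_lt_trans tb kb.
  apply: le_trans tb; apply: earlier => //.
  by apply: contraTneq bu => ->; rewrite ltxx.
have a'u : tau' a <= u.
  apply: (exhaustion_le eq eq' k0a (le k0 k0j k0a)) => k kb.
  by case: (eqVneq k j) => [->|kj]; [right; rewrite eat_a|left; apply: le].
have sum'_u := dom (rk j a).+1; rewrite sum_u in sum'_u.
(* Were [a] exhausted before [u], all items up to [a] would be gone before [u], too early for the
   deviator to collect [u] from them. *)
have aa' : tau' a = u.
  apply/le_anti; rewrite a'u /= leNgt; apply/negP => lt.
  have m0 : 0 <= Num.max t (tau' a) by rewrite le_max t0.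
  have : \sum_(o | (rk j o < (rk j a).+1)%N) eaten (rk' j) tau' o <= Num.max t (tau' a).
    apply: sum_eaten_le => // o; rewrite ltnS leq_eqVlt le_max => /orP[/eqP/inj_j->|h].
      by rewrite lexx orbT.
    by rewrite better'.
  by apply/negP; rewrite -ltNge; apply: lt_le_trans sum'_u; rewrite gt_max ta lt.
have known o : (rk j o <= rk j a)%N -> tau o = tau' o.
  rewrite leq_eqVlt => /orP[/eqP/inj_j->|h]; first by rewrite aa'.
  by apply: agr; left; apply: better.
have u0 : 0 <= u by lra.
apply: (agree_until_eaten eq eq' dev) => o ou.
  case: (leqP (rk j o) (rk j a)) => [/known // | lt jo].
  have := le_lt_trans (le_busy tau lt) jo; rewrite -/u; lra.
case: (leqP (rk j o) (rk j a)) => [/known // | lt jo].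
(* Collecting [u] from the items up to [a] fills the deviator's whole time until [u], which leaves
   no room for the worse item [o]. *)
suff : tau' o <= busy (rk' j) tau' (rk' j o) by lra.
apply: (busy_until (v := u) (Q := fun o => (rk j o < (rk j a).+1)%N)) => //.
- move=> b; rewrite ltnS leq_eqVlt => /orP[/eqP/inj_j->|h]; first by rewrite aa'.
  by have := better' b h; lra.
- by rewrite -leqNgt.
- exact: lt_le_trans ou.
Qed.

(** Induction down the true ranking. At [r = 0] agreement is vacuous because exhaustion times are
    positive; the second alternative persists once reached. *)
Lemma agree_busy r :
  agree_until tau tau' (busy (rk j) tau r) \/ 1 <= busy (rk j) tau r.
Proof.
elim: r => [|r [IHr|IHr]]; last by right; apply: le_trans IHr _; apply: busy_mono.
  left; rewrite /busy big_pred0 // => o.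
  by have := exhaustion_gt0 o eq; have := exhaustion_gt0 o eq'; lra.
case: (pickP (fun o => rk j o == r)) => [a /eqP ra | no]; last first.
  left; rewrite /busy (eq_bigl (fun o => (rk j o < r)%N)) // => o.
  by rewrite ltnS leq_eqVlt no.
rewrite -ra in IHr *; rewrite busyS //.
case: (ltP (busy (rk j) tau (rk j a)) (tau a)) => [ta|_]; last by left.
exact: agree_step.
Qed.

Lemma PS_weakly_strategyproof o : eaten (rk' j) tau' o = eaten (rk j) tau o.
Proof.
have cum r : \sum_(o | (rk j o < r)%N) eaten (rk' j) tau' o =
             \sum_(o | (rk j o < r)%N) eaten (rk j) tau o.
  apply/le_anti; rewrite dom andbT sum_eaten //.
  (* Under agreement the first [r] items are gone in both processes by [busy (rk j) tau r];
     otherwise the truthful amount is at least 1, the deviator's overall total. *)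
  case: (agree_busy r) => [agr|ge1].
    apply: sum_eaten_le => //; first exact: busy_ge0.
    by move=> b br; have h := le_busy tau br; rewrite -(agr b) //; left.
  apply: le_trans ge1; rewrite -(sum_eaten_eq1 j AO rk'_inj eq').
  by rewrite big_mkcond ler_sum // => b _; case: ifP => // _; apply: eaten_ge0.
have := cum (rk j o).+1; rewrite !big_rank_ltS // cum; exact: addIr.
Qed.

End WeakStrategyproofness.
End Equilibrium.

(** * From discrete phases to continuous time *)

Section Durations.
Variables (R : realFieldType) (K : nat) (d : nat -> R).
Hypothesis d_ge0 : forall m, 0 <= d m.
Implicit Types v w : nat -> bool.

Definition duration v : R := \sum_(m < K) (if v m then d m else 0).

Definition initial v := forall m, v m.+1 -> v m.

Lemma initial_leq v m m' : initial v -> (m <= m')%N -> v m' -> v m.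
Proof.
move=> iv /subnK <-; elim: (m' - m)%N => [//|q IHq]; rewrite addSn.
by move/iv.
Qed.

(** Initial segments of phases form a chain, which is why unions become maxima and differences
    become truncated subtractions of durations. *)
Lemma initial_nested v w : initial v -> initial w ->
  (forall m : 'I_K, v m -> w m) \/ (forall m : 'I_K, w m -> v m).
Proof.
move=> iv iw; case: (boolP [forall m : 'I_K, v m ==> w m]) => [/forallP h|].
  by left=> m; apply/implyP.
rewrite negb_forall => /existsP[m]; rewrite negb_imply => /andP[vm wm].
right=> m' wm'; apply: (initial_leq iv _ vm); rewrite leqNgt.
by apply: contra wm => lt; apply: (initial_leq iw (ltnW lt)).
Qed.

Lemma duration_le v w : (forall m : 'I_K, v m -> w m) -> duration v <= duration w.
Proof.
move=> vw; apply: ler_sum => m _; case: ifP => [/vw -> //|_].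
by case: ifP.
Qed.

Lemma eq_duration v w : (forall m : 'I_K, v m = w m) -> duration v = duration w.
Proof. by move=> vw; apply: eq_bigr => m _; rewrite vw. Qed.

Lemma duration_or v w : initial v -> initial w ->
  duration (fun m => v m || w m) = Num.max (duration v) (duration w).
Proof.
move=> iv iw; case: (initial_nested iv iw) => h; have le := duration_le h.
  by rewrite max_r //; apply: eq_duration => m; move: (h m); case: (v m) => // ->.
by rewrite max_l //; apply: eq_duration => m; move: (h m); case: (w m) => [->|]; rewrite ?orbF.
Qed.

Lemma duration_diff v w : initial v -> initial w ->
  duration (fun m => v m && ~~ w m) = Num.max 0 (duration v - duration w).
Proof.
move=> iv iw; case: (initial_nested iv iw) => h; have le := duration_le h.
  rewrite max_l ?subr_le0 //; apply: big1 => m _.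
  by case: ifP => // /andP[/h ->].
rewrite max_r ?subr_ge0 //; apply/eqP; rewrite eq_sym subr_eq; apply/eqP.
rewrite -big_split /=; apply: eq_bigr => m _; move: (h m).
by case: (w m) => [->|_]; rewrite ?andbT ?andbF ?add0r ?addr0.
Qed.

Lemma duration_exists (I : finType) (Q : pred I) (V : I -> nat -> bool) :
    (forall i, initial (V i)) ->
  duration (fun m => [exists i, Q i && V i m]) =
  \big[Num.max/0]_(i | Q i) duration (V i).
Proof.
move=> iV.
rewrite (@eq_duration _ (fun m => has (fun i => Q i && V i m) (index_enum I))); last first.
  move=> m; apply/existsP/hasP => [[i h]|[i _ h]]; last by exists i.
  by exists i => //; rewrite mem_index_enum.
elim: (index_enum I) => [|i r IHr].
  by rewrite big_nil; apply: big1.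
rewrite big_cons -IHr /=; case: (Q i) => /=; last exact: eq_duration.
rewrite -duration_or // => m /hasP[b br /andP[Qb Vb]].
by apply/hasP; exists b => //; rewrite Qb iV.
Qed.

End Durations.

(** * The most preferred available bundle *)

Section Top.
Variables (R : realType) (n p : nat).
Implicit Types (L : lexpref n p) (s : supply n p R) (x y : bundle n p).

Lemma item_rank_inj L i : injective (fun a => item_rank L i a : nat).
Proof. by move=> a b /ord_inj /perm_inj. Qed.

(** The most important type on which [x] and [y] differ decides. *)
Lemma prefer_intro L x y : x != y ->
    (forall i, x i != y i -> (forall i', more_important L i' i -> x i' = y i') ->
       item_better L i (x i) (y i)) ->
  prefer L x y.
Proof.
move=> neq better; have [i0 i0P] : exists i, x i != y i.
  apply/existsP; apply: contraR neq; rewrite negb_exists => /forallP h.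
  by apply/eqP/ffunP => i; have := h i; rewrite negbK => /eqP.
case: (arg_minnP (P := fun i => x i != y i) (fun i => imp_rank L i) i0P) => i neqi imin.
have same i' : more_important L i' i -> x i' = y i'.
  by move=> lt; apply/eqP; apply: contraLR lt; rewrite /more_important -leqNgt; apply: imin.
apply/existsP; exists i; rewrite better //=.
by apply/forallP => i'; apply/implyP => /same/eqP.
Qed.

Lemma top_available L s x : top L s = Some x -> forall i, 0 < s (i, x i).
Proof. by rewrite /top; case: pickP => // y /andP[/forallP h _] [<-]. Qed.

Lemma top_best L s x i b : top L s = Some x -> item_better L i b (x i) -> s (i, b) <= 0.
Proof.
move=> topx bx; rewrite leNgt; apply/negP => sb.
have av := top_available topx.
move: topx; rewrite /top; case: pickP => // z /andP[_ /forallP h] [zx].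
move: h; rewrite {z}zx => h.
(* Exchanging the single component [i] for [b] gives an available bundle that beats [x] whatever the
   importance order. *)
pose y : bundle n p := [ffun i' => if i' == i then b else x i'].
have avy : available s y.
  by apply/forallP => i'; rewrite ffunE; case: eqP => [->|].
have yx : y != x.
  apply: contraTneq bx => yx; rewrite -yx /y ffunE eqxx /item_better.
  by rewrite ltnn.
have := h y; rewrite avy yx /= => /existsP[i0 /andP[lt _]].
move: lt; rewrite /item_better /y ffunE; case: eqP => [->|_]; last by rewrite ltnn.
by move/(ltn_trans bx); rewrite ltnn.
Qed.

Lemma top_ex L s : (forall i, exists a, 0 < s (i, a)) -> exists x, top L s = Some x.
Proof.
move=> ne.
have best i : exists a, (0 < s (i, a)) &&
    [forall b, (0 < s (i, b)) ==> (item_rank L i a <= item_rank L i b)%N].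
  have [a0 sa0] := ne i.
  case: (arg_minnP (P := fun a => 0 < s (i, a)) (fun a => item_rank L i a) sa0) => a sa amin.
  by exists a; rewrite sa; apply/forallP => b; apply/implyP; apply: amin.
(* The best remaining item of each type, taken separately, forms the top bundle. *)
pose x : bundle n p := [ffun i => xchoose (best i)].
have xP i : 0 < s (i, x i) /\
    forall b, 0 < s (i, b) -> (item_rank L i (x i) <= item_rank L i b)%N.
  have /andP[h1 /forallP h2] := xchooseP (best i); rewrite !ffunE; split=> // b.
  by apply/implyP.
rewrite /top; case: pickP => [y _|/(_ x) /negbT/negP[]]; first by exists y.
apply/andP; split; first by apply/forallP => i; case: (xP i).
apply/forallP => y; apply/implyP => /andP[/forallP avy neq].
apply: prefer_intro => [|i neqi _]; first by rewrite eq_sym.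
rewrite /item_better ltn_neqAle (proj2 (xP i)) ?avy // andbT.
by apply: contra neqi => /eqP/item_rank_inj ->.
Qed.

End Top.

(** * The run of MPS as one equilibrium per type *)

Section Run.
Variables (R : realType) (n p : nat) (P : profile n p).
Local Notation "'st' m" := (iter m (step P) (init n p R)) (at level 10).
Local Notation s m := (st m).1.
Local Notation d m := (phase_len P (s m)).
Local Notation K := (p * n).+1.

Definition eating k (s : supply n p R) (o : item n p) : bool :=
  if top (P k) s is Some x then in_bundle o x else false.

(** Phases after complete exhaustion have the default length 1, but are not counted because no
    supply is positive then. *)
Definition exhaustion_time i a : R :=
  duration K (fun m => d m) (fun m => 0 < s m (i, a)).

Lemma supplyS m o : s m.+1 o = s m o - (rate P (s m) o)%:R * d m.
Proof. by rewrite iterS /step; case: (st m) => s0 A0; rewrite ffunE. Qed.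

Lemma assignmentS m k y :
  (st m.+1).2 k y = (st m).2 k y + (if top (P k) (s m) == Some y then d m else 0).
Proof.
rewrite iterS /step; case: (st m) => s0 A0 /=.
case: (top (P k) s0) => [x|]; last by rewrite addr0.
by rewrite ffunE (inj_eq (@Some_inj _)) eq_sym.
Qed.

Lemma rateE (s0 : supply n p R) o : (rate P s0 o)%:R = \sum_k (eating k s0 o)%:R :> R.
Proof.
rewrite /rate -sum1dep_card natr_sum big_mkcond /=.
by apply: eq_bigr => k _; rewrite /eating; case: top => // x; case: in_bundle.
Qed.

Lemma phase_len_ge0 (s0 : supply n p R) : (forall o, 0 <= s0 o) -> 0 <= phase_len P s0.
Proof. by move=> h; apply: le_bigmin => // o _; rewrite divr_ge0. Qed.

Lemma rate_phase_len_le (s0 : supply n p R) o : 0 <= s0 o ->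
  (rate P s0 o)%:R * phase_len P s0 <= s0 o.
Proof.
move=> h; case: (posnP (rate P s0 o)) => [-> |r0]; first by rewrite mul0r.
rewrite mulrC -ler_pdivlMr ?ltr0n //.
by rewrite /phase_len (bigmin_le_cond _ (P := fun o => (0 < rate P s0 o)%N)).
Qed.

Lemma supply_ge0 m o : 0 <= s m o.
Proof.
elim: m o => [|m IHm] o; first by rewrite ffunE.
by rewrite supplyS subr_ge0 rate_phase_len_le.
Qed.

Lemma d_ge0 m : 0 <= d m.
Proof. by apply: phase_len_ge0 => o; apply: supply_ge0. Qed.

Lemma supply_noninc m o : s m.+1 o <= s m o.
Proof. by rewrite supplyS lerBlDr lerDl mulr_ge0 // d_ge0. Qed.

Lemma supply_le1 m o : s m o <= 1.
Proof.
elim: m => [|m IHm]; first by rewrite ffunE.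
exact: le_trans (supply_noninc m o) IHm.
Qed.

Lemma sum_eating k (s0 : supply n p R) i :
  \sum_a (eating k s0 (i, a))%:R = (top (P k) s0 != None)%:R :> R.
Proof.
rewrite /eating; case: top => [x|] /=; last by rewrite big1.
rewrite (bigD1 (x i)) //= /in_bundle eqxx big1 ?addr0 // => a.
by rewrite eq_sym => /negbTE ->.
Qed.

(** Whoever eats consumes one item of every type. Hence if any item is left, every type has one left
    and some bundle is available. *)
Lemma sum_supply m i i' : \sum_a s m (i, a) = \sum_a s m (i', a).
Proof.
elim: m => [|m IHm]; first by apply: eq_bigr => a _; rewrite !ffunE.
have sumS i0 : \sum_a s m.+1 (i0, a) =
    \sum_a s m (i0, a) - (\sum_k (top (P k) (s m) != None)%:R) * d m.
  under eq_bigr do rewrite supplyS rateE.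
  rewrite big_split /= sumrN -mulr_suml exchange_big /=.
  by under [X in _ - X * _]eq_bigr do rewrite sum_eating.
by rewrite !sumS IHm.
Qed.

Lemma top_some m o L : 0 < s m o -> exists x, top L (s m) = Some x.
Proof.
case: o => i0 a0 so; apply: top_ex => i; apply/existsP; apply: contraT.
rewrite negb_exists => /forallP no.
have : 0 < \sum_a s m (i, a).
  rewrite (sum_supply m i i0) (bigD1 a0) //= ltr_wpDr // sumr_ge0 // => a _.
  exact: supply_ge0.
by rewrite big1 ?ltxx // => a _; apply/le_anti; rewrite supply_ge0 leNgt no.
Qed.

(** This decouples the types: the condition involves neither the importance order nor the supplies
    of other types. *)
Lemma eatingE m k i a : eating k (s m) (i, a) =
  (0 < s m (i, a)) && ~~ [exists b, item_better (P k) i b a && (0 < s m (i, b))].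
Proof.
apply/idP/andP.
  rewrite /eating; case E: top => [x|] //; rewrite /in_bundle /= => /eqP <-.
  split; first exact: (top_available E).
  rewrite negb_exists; apply/forallP => b; rewrite negb_and -implybE; apply/implyP => bx.
  by rewrite -leNgt; apply: top_best E bx.
case=> sa; have [x E] := top_some (P k) sa; rewrite /eating E /in_bundle /=.
apply: contraR => neq; have [lt|gt|/item_rank_inj eq] :=
  ltngtP (item_rank (P k) i (x i)) (item_rank (P k) i a).
- by apply/existsP; exists (x i); rewrite /item_better lt (top_available E).
- by have := top_best E gt; rewrite leNgt sa.
- by rewrite eq eqxx in neq.
Qed.

Lemma exhausts m o : 0 < s m o -> exists2 o', 0 < s m o' & s m.+1 o' = 0.
Proof.
move=> so; case: o so => i a so.
(* Any agent will do; items of a type and agents share the index set ['I_n], so [a] provides one. *)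
have [x E] := top_some (P a) so.
have r0 : (0 < rate P (s m) (i, x i))%N.
  by apply/card_gt0P; exists a; rewrite inE E /in_bundle eqxx.
(* The default 1 of the minimum does not bind, so some item attains the phase length and runs
   out. *)
have le1 o' : (0 < rate P (s m) o')%N -> s m o' / (rate P (s m) o')%:R <= 1.
  move=> ro; rewrite ler_pdivrMr ?ltr0n // mul1r.
  by apply: le_trans (supply_le1 m o') _; rewrite ler1n.
have [o' ro' dE] := eq_bigmin _ (fun o => (0 < rate P (s m) o)%N)
  (fun o => s m o / (rate P (s m) o)%:R) r0 le1.
exists o'.
  case/card_gt0P: ro' => k'; rewrite inE; case E': top => [x'|] // /eqP.
  by case: o' dE => i' a' _ /= <-; apply: (top_available E').
rewrite supplyS /phase_len dE mulrC divfK ?subrr //.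
by rewrite pnatr_eq0 -lt0n.
Qed.

Lemma supply_final o : s K o = 0.
Proof.
pose Z m := #|[set o | s m o == 0]|.
(* Each phase exhausts a new item while any is left; at [m = K] the second alternative would exceed
   the number of items [p * n]. *)
have H m : (forall o, s m o = 0) \/ (m <= Z m)%N.
  elim: m => [|m IHm]; first by right.
  have stay o0 : s m o0 = 0 -> s m.+1 o0 = 0.
    by move=> h; apply/le_anti; rewrite supply_ge0 -{1}h supply_noninc.
  case: IHm => [h|mZ]; first by left=> o0; apply: stay.
  case: (pickP (fun o => 0 < s m o)) => [o1 /exhausts[o' so' s'o']|no]; last first.
    by left=> o0; apply: stay; apply/le_anti; rewrite supply_ge0 leNgt no.
  right; apply: leq_ltn_trans mZ _; apply: proper_card; apply/properP; split.
    by apply/subsetP => b; rewrite !inE => /eqP/stay ->.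
  by exists o'; rewrite inE ?s'o' // gt_eqF.
case: (H K) => [//|]; rewrite leqNgt ltnS => /negP[].
by apply: leq_trans (max_card _) _; rewrite card_prod !card_ord.
Qed.

(** Supplies never increase, so the phases spent on an item are those where it remains minus those
    where a better one remains: a difference of initial segments. *)
Lemma duration_eating k i a :
  duration K (fun m => d m) (fun m => eating k (s m) (i, a)) =
  eaten (fun b => item_rank (P k) i b) (exhaustion_time i) a.
Proof.
have init_s b : initial (fun m => 0 < s m (i, b)).
  by move=> m h; apply: lt_le_trans h (supply_noninc _ _).
rewrite /eaten /busy -(duration_exists _ d_ge0) // -(duration_diff _ d_ge0) //.
  by apply: eq_bigr => m _; rewrite eatingE.
move=> m /existsP[b /andP[ba sb]]; apply/existsP; exists b.
by rewrite ba init_s.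
Qed.

Lemma MPS_equilibrium i :
  equilibrium (fun k b => item_rank (P k) i b) (exhaustion_time i).
Proof.
move=> a; under eq_bigr do rewrite -duration_eating.
(* Conservation of supply; at [K] nothing is left, so the durations sum to 1. *)
have E m : s m (i, a) = 1 - \sum_k duration m (fun m => d m) (fun m => eating k (s m) (i, a)).
  elim: m => [|m IHm].
    by rewrite ffunE big1 ?subr0 // => k _; rewrite /duration big_ord0.
  rewrite supplyS IHm rateE mulr_suml -addrA -opprD -big_split /=.
  congr (_ - _); apply: eq_bigr => k _; rewrite /duration big_ord_recr /=.
  by case: eating; rewrite ?mul1r ?mul0r.
by have := supply_final (i, a); rewrite E => /eqP; rewrite subr_eq0 => /eqP <-.
Qed.

Lemma MPS_marginal k i a : \sum_(y : bundle n p | y i == a) MPS R P k y =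
  eaten (fun b => item_rank (P k) i b) (exhaustion_time i) a.
Proof.
rewrite -duration_eating /MPS; elim: K => [|m IHm].
  by rewrite /duration big_ord0 big1 // => y _; rewrite ffunE.
under eq_bigr do rewrite assignmentS.
rewrite big_split /= IHm /duration big_ord_recr /=; congr (_ + _).
rewrite /eating; case: top => [x|]; last by rewrite big1.
rewrite -big_mkcondr /in_bundle /=; case: eqP => [xa|xa].
  rewrite (big_pred1 x) // => y; rewrite /= (inj_eq (@Some_inj _)).
  by case: (eqVneq x y) => [<-|]; rewrite ?xa ?eqxx ?andbF //.
rewrite big_pred0 // => y; rewrite (inj_eq (@Some_inj _)).
by case: (eqVneq x y) => [<-|]; rewrite ?andbF // andbT; apply/eqP.
Qed.

End Run.

(** * Cumulative sums along a ranking *)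

Section Cumulative.
Variables (R : realFieldType) (O : finType) (rk : O -> nat).
Hypothesis rk_inj : injective rk.
Implicit Types f : O -> R.

Lemma cumulative_ge0 f : (forall a, 0 <= \sum_(o | (rk o <= rk a)%N) f o) ->
  forall r, 0 <= \sum_(o | (rk o < r)%N) f o.
Proof.
move=> f0; elim=> [|r IHr]; first by rewrite big_pred0.
case: (pickP (fun o => rk o == r)) => [a /eqP <-|no]; first exact: f0.
by rewrite (eq_bigl (fun o => (rk o < r)%N)) // => o; rewrite ltnS leq_eqVlt no.
Qed.

Lemma cumulative_eq0 f : (forall a, \sum_(o | (rk o <= rk a)%N) f o = 0) ->
  forall o, f o = 0.
Proof.
move=> f0; have cum r : \sum_(o | (rk o < r)%N) f o = 0.
  apply/le_anti; rewrite -oppr_ge0 -sumrN !cumulative_ge0 // => a.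
    by rewrite f0.
  by rewrite sumrN f0 oppr0.
by move=> o; have := f0 o; rewrite big_rank_ltS // cum addr0.
Qed.

End Cumulative.

(** * Lexicographic dominance, one type after another *)

Section Lexicographic.
Variables (R : realFieldType) (n p : nat) (L : lexpref n p) (j : 'I_n).
Variable g : bundle n p -> R.
Implicit Types (x y z : bundle n p) (l : nat).

(** The less important components are overwritten by the dummy [j], so equal prefixes mean agreement
    on the [l] most important types. *)
Definition prefix l y : bundle n p :=
  [ffun i => if (imp_rank L i < l)%N then y i else j].

Lemma prefix_eqP l x y :
  reflect (forall i, (imp_rank L i < l)%N -> y i = x i) (prefix l y == prefix l x).
Proof.
apply: (iffP eqP) => [/ffunP h i lt|h].
  by have := h i; rewrite !ffunE lt.
by apply/ffunP => i; rewrite !ffunE; case: ifP => // /h.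
Qed.

Lemma prefixS (l : 'I_p) x y (i := (imp_rank L)^-1%g l) :
  (prefix l.+1 y == prefix l.+1 x) = (prefix l y == prefix l x) && (y i == x i).
Proof.
have il : imp_rank L i = l by rewrite /i permKV.
apply/prefix_eqP/andP => [h|[/prefix_eqP h /eqP hi] i'].
  split; last by apply/eqP/h; rewrite il.
  by apply/prefix_eqP => i' lt; apply: h; apply: ltnW.
rewrite ltnS leq_eqVlt => /orP[/eqP E|/h //].
by have -> : i' = i by apply: (@perm_inj _ (imp_rank L)); apply: ord_inj; rewrite il.
Qed.

Definition prefix_better l x y := [exists i, [&& (imp_rank L i < l)%N,
  item_better L i (y i) (x i) &
  [forall i', more_important L i' i ==> (y i' == x i')]]].

Lemma prefix_better_prefix l x y :
  prefix_better l x (prefix l y) = prefix_better l x y.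
Proof.
apply: eq_existsb => i; case lt: (imp_rank L i < l)%N => //=.
rewrite ffunE lt; congr (_ && _); apply: eq_forallb => i'.
rewrite /more_important ffunE; case lt': (imp_rank L i' < imp_rank L i)%N => //=.
by rewrite (ltn_trans lt' lt).
Qed.

Lemma prefix_betterN l x y : prefix l y == prefix l x -> prefix_better l x y = false.
Proof.
move/prefix_eqP => h; apply/existsP => -[i /and3P[lt + _]].
by rewrite /item_better h // ltnn.
Qed.

Definition worst i : 'I_n := [arg max_(a > j) item_rank L i a].

Lemma item_rank_worst i a : (item_rank L i a <= item_rank L i (worst i))%N.
Proof. by rewrite /worst; case: arg_maxnP => // b _; apply. Qed.

Definition cutoff l x b : bundle n p := [ffun i =>
  if (imp_rank L i < l)%N then x i else if imp_rank L i == l :> nat then b else worst i].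

(* The upper contour set of the bundle that follows [x] on the types of rank
   below [l], takes [b] at rank [l] and is worst possible afterwards. *)
Lemma upper_cutoff (l : 'I_p) x b y (i := (imp_rank L)^-1%g l) :
  (y \in upper L (cutoff l x b)) = prefix_better l x y ||
    (prefix l y == prefix l x) && (item_rank L i (y i) <= item_rank L i b)%N.
Proof.
have il : imp_rank L i = l by rewrite /i permKV.
have ci : cutoff l x b i = b by rewrite ffunE il ltnn eqxx.
have cx i' : (imp_rank L i' < l)%N -> cutoff l x b i' = x i' by rewrite ffunE => ->.
have same_i i' : imp_rank L i' = l :> nat -> i' = i.
  by move=> E; apply: (@perm_inj _ (imp_rank L)); apply: ord_inj; rewrite il.
rewrite inE; apply/orP/orP => [[|/eqP ->]|].
- case/existsP=> i' /andP[better /forallP same].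
  have sameP i'' : (imp_rank L i'' < imp_rank L i')%N -> y i'' = cutoff l x b i''.
    by move=> lt; apply/eqP; have := same i''; rewrite /more_important lt.
  case: (ltngtP (imp_rank L i') l) => [lt|gt|/same_i E].
  + left; apply/existsP; exists i'; rewrite lt -cx // better /=.
    apply/forallP => i''; apply/implyP => lt'.
    by rewrite sameP // cx // (ltn_trans lt' lt).
  + right; rewrite sameP ?il // ci leqnn andbT.
    by apply/prefix_eqP => i'' lt; rewrite sameP ?cx // (ltn_trans lt gt).
  + right; rewrite E /item_better ci in better; rewrite ltnW // andbT.
    by apply/prefix_eqP => i'' lt; rewrite sameP ?cx // E il.
- by right; rewrite ci leqnn andbT; apply/prefix_eqP => i'; apply: cx.
- case=> [/existsP[i' /and3P[lt better /forallP same]]|/andP[/prefix_eqP same le]].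
    left; apply/existsP; exists i'; rewrite cx // better /=.
    apply/forallP => i''; apply/implyP => lt'.
    by have := same i''; rewrite lt' cx // (ltn_trans lt' lt).
  case: (eqVneq y (cutoff l x b)) => [|neq]; [by right|left].
  apply: prefer_intro neq _ => i' neq _.
  rewrite /item_better ltn_neqAle (inj_eq (@item_rank_inj _ _ L i')) neq /=.
  case: (ltngtP (imp_rank L i') l) => [lt|gt|/same_i ->]; last by rewrite ci.
    by rewrite same // cx // eqxx in neq.
  by rewrite ffunE ltnNge (ltnW gt) /= gtn_eqF // item_rank_worst.
Qed.

Definition prefix_null l := forall x, \sum_(y | prefix l y == prefix l x) g y = 0.

Lemma sum_prefix l (Q : pred (bundle n p)) :
  \sum_(y | Q y) g y = \sum_z \sum_(y | Q y && (prefix l y == z)) g y.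
Proof. exact: (partition_big (prefix l) xpredT). Qed.

(** Being better on the first [l] types depends on the prefix alone, so the set is a union of prefix
    classes, each of mass zero. *)
Lemma prefix_null_better l x : prefix_null l -> \sum_(y | prefix_better l x y) g y = 0.
Proof.
move=> null; rewrite (sum_prefix l) big1 // => z _.
case: (pickP (fun y => prefix_better l x y && (prefix l y == z))) => [y0|no].
  case/andP=> b0 /eqP <-; rewrite -[RHS](null y0); apply: eq_bigl => y.
  case: eqVneq => [E|]; rewrite ?andbF // andbT.
  by rewrite -prefix_better_prefix E prefix_better_prefix.
by rewrite big_pred0.
Qed.

Hypothesis g_dom : forall x, 0 <= \sum_(y in upper L x) g y.

Lemma prefix_nullS (l : 'I_p) (i := (imp_rank L)^-1%g l) :
    ((forall b, 0 <= \sum_(y : bundle n p | (item_rank L i (y i) <= item_rank L i b)%N) g y) ->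
     forall a, \sum_(y : bundle n p | y i == a) g y = 0) ->
  prefix_null l -> prefix_null l.+1.
Proof.
move=> marg null.
pose S z b := \sum_(y : bundle n p | (item_rank L i (y i) <= item_rank L i b)%N && (prefix l y == z)) g y.
have S_ge0 z b : 0 <= S z b.
  case: (pickP (fun y => prefix l y == z)) => [x /eqP <-|no]; last first.
    by rewrite /S big_pred0 // => y; rewrite no andbF.
  (* This upper contour set splits into a part decided by the prefix, which is null, and exactly the
     set summed in [S]. *)
  have := g_dom (cutoff l x b).
  rewrite (bigID (prefix_better l x)) /=.
  rewrite (eq_bigl (prefix_better l x)) ?prefix_null_better // => [|y]; last first.
    by rewrite upper_cutoff; case: prefix_better; rewrite ?andbF.
  rewrite add0r /S; congr (_ <= _); apply: eq_bigl => y; rewrite upper_cutoff -/i.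
  rewrite [RHS]andbC; case: (boolP (prefix l y == _)) => [/prefix_betterN ->|_] //=.
    by rewrite andbT.
  by rewrite orbF andbN.
have marg0 : forall a, \sum_(y : bundle n p | y i == a) g y = 0.
  by apply: marg => b; rewrite (sum_prefix l) sumr_ge0 // => z _; apply: S_ge0.
(* The terms are nonnegative, and over all [z] they add up to a sum of type-[i] marginals, which
   vanish. *)
have S_eq0 z b : S z b = 0.
  apply: (psumr_eq0P (P := xpredT) (F := S^~ b)) => //.
  rewrite -(sum_prefix l).
  rewrite (partition_big (fun y : bundle n p => y i)
     (fun a => (item_rank L i a <= item_rank L i b)%N)) //= big1 // => a le.
  rewrite -[RHS](marg0 a); apply: eq_bigl => y.
  by case: eqP => [->|_]; rewrite ?andbF ?le.
move=> x; rewrite (eq_bigl _ _ (prefixS l x)).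
pose f a := \sum_(y : bundle n p | (prefix l y == prefix l x) && (y i == a)) g y.
(* The sums [S] are the cumulative sums of [f] along the ranking of type [i]. *)
apply: (cumulative_eq0 (@item_rank_inj _ _ L i) (f := f)) => b.
rewrite -[RHS](S_eq0 (prefix l x) b) /S.
rewrite [RHS](partition_big (fun y : bundle n p => y i)
     (fun a => (item_rank L i a <= item_rank L i b)%N)) /=; last by move=> y /andP[].
apply: eq_bigr => a le; apply: eq_bigl => y.
by case: (eqVneq (y i) a) => [->|_]; rewrite ?andbF ?le ?andbT.
Qed.

(** Induction on the prefix length: at 0 all bundles share one class, whose mass is the total; at
    [p] each class is a single bundle. *)
Lemma lex_null :
    \sum_y g y = 0 ->
    (forall i, (forall b, 0 <= \sum_(y : bundle n p | (item_rank L i (y i) <= item_rank L i b)%N) g y) ->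
       forall a, \sum_(y : bundle n p | y i == a) g y = 0) ->
  forall x, g x = 0.
Proof.
move=> total marg x.
have null l : (l <= p)%N -> prefix_null l.
  elim: l => [_ z|l IHl lp].
    by rewrite -[RHS]total; apply: eq_bigl => y; apply/prefix_eqP.
  exact: (@prefix_nullS (Ordinal lp)) (marg _) (IHl (ltnW lp)).
rewrite -[RHS](null p (leqnn p) x) (big_pred1 x) // => y.
apply/prefix_eqP/eqP => [h|-> //].
by apply/ffunP => i; apply: h.
Qed.

End Lexicographic.

(** * Weak strategyproofness of MPS *)

Lemma update_other n p (P : profile n p) j L' k : k != j -> update P j L' k = P k.
Proof. by rewrite /update => /negbTE ->. Qed.

Lemma MPS_total (R : realType) n p (P : profile n p) k :
  \sum_y MPS R P k y = 1.
Proof.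
case: p P => [|p] P.
  (* Without types there is only the empty bundle; the successor in [(p * n).+1] runs exactly one
     phase, of default length 1, which gives it mass 1. *)
  have [x topx] : exists x, top (P k) (init n 0 R).1 = Some x by apply: top_ex => -[].
  rewrite (big_pred1 x) => [|y]; last by apply/esym/eqP/ffunP => -[].
  by rewrite /MPS assignmentS topx eqxx ffunE add0r /phase_len big_pred0 // => -[[]].
rewrite (partition_big (fun y : bundle n p.+1 => y ord0) xpredT) //=.
under eq_bigr do rewrite MPS_marginal.
rewrite (sum_eaten_eq1 (rk := fun k b => item_rank (P k) ord0 b)) //.
  by move=> k'; apply: item_rank_inj.
exact: MPS_equilibrium.
Qed.

Theorem theorem6 (R : realType) (n p : nat) (P : profile n p) (j : 'I_n)
    (L' : lexpref n p) :
  sd_dom (P j) (MPS R (update P j L') j) (MPS R P j) ->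
  MPS R (update P j L') j = MPS R P j.
Proof.
move=> dom; apply/ffunP => x; apply/eqP; rewrite -subr_eq0; apply/eqP.
pose g y := MPS R (update P j L') j y - MPS R P j y.
have sum_g Q : \sum_(y | Q y) g y =
    \sum_(y | Q y) MPS R (update P j L') j y - \sum_(y | Q y) MPS R P j y.
  by rewrite big_split sumrN.
apply: (lex_null (L := P j) j (g := g)) => [z||i marg_dom a].
- by rewrite sum_g subr_ge0; apply: dom.
- by rewrite sum_g !MPS_total subrr.
pose rk k b : nat := item_rank (P k) i b.
pose rk' k b : nat := item_rank (update P j L' k) i b.
pose tau := exhaustion_time R P i; pose tau' := exhaustion_time R (update P j L') i.
have margE b : \sum_(y : bundle n p | y i == b) g y =
    eaten (rk' j) tau' b - eaten (rk j) tau b.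
  by rewrite sum_g !MPS_marginal.
rewrite margE; apply/eqP; rewrite subr_eq0; apply/eqP.
apply: (PS_weakly_strategyproof (rk := rk) (rk' := rk')).
- by [].
- by move=> k; apply: item_rank_inj.
- by move=> k; apply: item_rank_inj.
- exact: MPS_equilibrium.
- exact: MPS_equilibrium.
- by move=> k kj; rewrite /rk' update_other.
(* The marginal dominance from [lex_null] bounds sums up to the rank of an item [b];
   [cumulative_ge0] extends it to every threshold [r]. *)
- move=> r; rewrite -subr_ge0 -sumrB; apply: cumulative_ge0 => b.
  have := marg_dom b; congr (_ <= _).
  rewrite (partition_big (fun y : bundle n p => y i) (fun c => (rk j c <= rk j b)%N)) //=.
  apply: eq_bigr => c le; rewrite -margE; apply: eq_bigl => y.
  by case: eqP => [->|_]; rewrite ?andbF ?le.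
Qed.
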